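(* Assume that $\mathfrak{b}=\mathfrak{c}$. Let $S\subseteq[\mathbb{N}]^{\infty}$ be a $\le^*$-refinement of some $\mathfrak{b}$-scale. Then $S$ has a $\le^*$-refinement $S'$ such that the set $S'\cup\mathrm{Fin}$ (as a subspace of $P(\mathbb{N})$) is $\mathsf{U}_{\mathrm{id}}(\Gamma,\Gamma)$ but is not $\mathsf{U}_k(\Gamma,\Gamma)$ for any natural number $k$. Moreover, if $\mathfrak{p}=\mathfrak{c}$, then $S'$ can be taken so that the set $S'\cup\mathrm{Fin}$ is, in addition, $\mathsf{S}_1(\Omega,\Omega)$.
   Context: $\mathbb{N}=\{1,2,\dots\}$. $P(\mathbb{N})$ carries the Cantor space topology (identify sets with characteristic functions in $\{0,1\}^{\mathbb{N}}$). $\mathrm{Fin}$ is the family of finite subsets of $\mathbb{N}$, and $[\mathbb{N}]^\infty$ the family of infinite subsets. Each $a\in[\mathbb{N}]^\infty$ is identified with its increasing enumeration $a(1)<a(2)<\cdots$. For $a,b\in\mathbb{N}^{\mathbb{N}}$, $a\le^* b$ means $a(n)\le b(n)$ for all but finitely many $n$. A set is unbounded if it has no $\le^*$-upper bound in $\mathbb{N}^{\mathbb{N}}$. $\mathfrak{b}$ is the minimal cardinality of an unbounded subset of $\mathbb{N}^{\mathbb{N}}$, and $\mathfrak{c}=2^{\aleph_0}$. A set $A\subseteq[\mathbb{N}]^\infty$ is centered if every finite subset of $A$ has infinite intersection; $p\in[\mathbb{N}]^\infty$ is a pseudointersection of $A$ if $p\setminus s$ is finite for all $s\in A$; $\mathfrak{p}$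 is the minimal cardinality of a centered set with no pseudointersection. A $\mathfrak{b}$-scale is an unbounded set $\{s_\alpha:\alpha<\mathfrak{b}\}\subseteq[\mathbb{N}]^\infty$ with $s_\alpha\le^* s_\beta$ for all $\alpha<\beta<\mathfrak{b}$. For a binary relation $R$ on $[\mathbb{N}]^\infty$, a set $B\subseteq[\mathbb{N}]^\infty$ is an $R$-refinement of $A\subseteq[\mathbb{N}]^\infty$ if there is a surjection $\varphi\colon A\to B$ with $a\,R\,\varphi(a)$ for all $a\in A$. Spaces are infinite Hausdorff. A cover of a space $X$ is a family $\mathcal{U}$ of subsets of $X$ with $X=\bigcup\mathcal{U}$ and $X\notin\mathcal{U}$. $\Gamma(X)$ is the family of infinite open covers $\mathcal{U}$ of $X$ such that each $x\in X$ belongs to all but finitely many members of $\mathcal{U}$. $\Omega(X)$ is the family of open covers $\mathcal{U}$ of $X$ such that every finite subset of $X$ is contained in some member of $\mathcal{U}$. For types of covers $\mathrm{A},\mathrm{B}$: $X$ is $\mathsf{S}_1(\mathrm{A},\mathrm{B})$ if for all $\mathcal{U}_1,\mathcal{U}_2,\dots\in\mathrm{A}(X)$ there are $U_n\in\mathcal{U}_n$ with $\{U_n:n\in\mathbb{N}\}\in\mathrm{B}(X)$. For $f\in\mathbb{N}^{\mathbb{N}}$, $X$ is $\mathsf{U}_f(\mathrm{A},\mathrm{B})$ if for all $\mathcal{U}_1,\mathcal{U}_2,\dots\in\mathrm{A}(X)$, none having a finite subcover, there are $\mathcal{F}_n\subseteq\mathcal{U}_n$ with $|\mathcal{F}_n|\le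 f(n)$ for all $n$ and $\{\bigcup\mathcal{F}_n:n\in\mathbb{N}\}\in\mathrm{B}(X)$. $\mathsf{U}_k$ is $\mathsf{U}_f$ for the constant function $f(n)=k$, and $\mathsf{U}_{\mathrm{id}}$ is $\mathsf{U}_f$ for the identity function $f(n)=n$. *)

(* Defs.v *)
From mathcomp Require Import all_boot all_order.
From mathcomp Require Import all_classical.
From mathcomp Require Import topology cantor.

Set Implicit Arguments.
Unset Strict Implicit.
Unset Printing Implicit Defensive.

Local Open Scope classical_set_scope.
Local Open Scope card_scope.
Local Open Scope nat_scope.

(* The positive integers {1,2,...} are represented by nat through the order
   isomorphism n |-> n.+1: the natural number n, used as an element of a subset
   of N, as a value of a function or as an index of a sequence, stands for the
   positive integer n.+1. This matters only in [Usel]. Points of P(N) are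
   characteristic functions, i.e., elements of [cantor_space]. *)

Definition supp (a : cantor_space) : set nat := [set n | (a : nat -> bool) n].

Definition Fin : set cantor_space := [set a | finite_set (supp a)].

Definition infsets : set cantor_space := [set a | infinite_set (supp a)].

(* The increasing enumeration of an infinite set (junk on finite sets). *)
Definition enum_of (a : cantor_space) : nat -> nat :=
  xget (id : nat -> nat)
    [set e | {homo e : m n / m < n} /\ range e = supp a].

Definition le_star (f g : nat -> nat) : Prop := \forall n \near \oo, f n <= g n.

Definition le_star_sets (a b : cantor_space) : Prop :=
  le_star (enum_of a) (enum_of b).

Definition unbounded (F : set (nat -> nat)) : Prop :=
  ~ exists g, forall f, F f -> le_star f g.

Definition centered (A : set cantor_space) : Prop :=
  A `<=` infsets /\
  forall F : set cantor_space, F `<=` A -> finite_set F ->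
    infinite_set (\bigcap_(a in F) supp a).

Definition pseudointersection (A : set cantor_space) (p : cantor_space) : Prop :=
  infsets p /\ forall s, A s -> finite_set (supp p `\` supp s).

(* The cardinality of K is the minimal cardinality of a set satisfying P. *)
Definition is_min_card (T U : Type) (P : set (set T)) (K : set U) : Prop :=
  (exists2 A, P A & A #= K) /\ forall A, P A -> K #<= A.

Definition is_b (U : Type) (K : set U) : Prop := is_min_card unbounded K.

Definition is_p (U : Type) (K : set U) : Prop :=
  is_min_card
    [set A | centered A /\ ~ exists p, pseudointersection A p] K.

Definition b_eq_c : Prop := is_b [set: nat -> bool].

Definition p_eq_c : Prop := is_p [set: nat -> bool].

(* (I, R) is isomorphic to an initial ordinal, i.e., to a cardinal; R is the
   reflexive order. *)
Definition initial_ordinal (I : Type) (R : rel I) : Prop :=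
  wochoice.well_order R /\
  forall i, ~ ([set: I] #<= [set j | R j i /\ j <> i]).

Definition b_scale (A : set cantor_space) : Prop :=
  [/\ A `<=` infsets,
      unbounded (enum_of @` A) &
      exists (I : Type) (R : rel I) (s : I -> cantor_space),
        [/\ initial_ordinal R, is_b [set: I], A = range s &
            forall i j, R i j -> i <> j -> le_star_sets (s i) (s j)]].

Definition refinement (R : cantor_space -> cantor_space -> Prop)
    (A B : set cantor_space) : Prop :=
  [/\ A `<=` infsets, B `<=` infsets &
      exists phi : cantor_space -> cantor_space,
        phi @` A = B /\ forall a, A a -> R a (phi a)].

Definition cover_type := forall X : topologicalType, set (set (set X)).

Definition cover (X : Type) (UU : set (set X)) : Prop :=
  \bigcup_(V in UU) V = setT /\ ~ UU setT.

Definition open_cover (X : topologicalType) (UU : set (set X)) : Prop :=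
  cover UU /\ UU `<=` open.

Definition Gamma : cover_type := fun X => [set UU |
  [/\ open_cover UU, infinite_set UU &
      forall x : X, finite_set [set V | UU V /\ ~ V x]]].

Definition Omega : cover_type := fun X => [set UU |
  open_cover UU /\
  forall F : set X, finite_set F -> exists2 V, UU V & F `<=` V].

Definition has_finite_subcover (X : Type) (UU : set (set X)) : Prop :=
  exists F : set (set X), [/\ F `<=` UU, finite_set F & cover F].

Definition S1 (A B : cover_type) (X : topologicalType) : Prop :=
  forall UU : nat -> set (set X), (forall n, A X (UU n)) ->
    exists V : nat -> set X, (forall n, UU n (V n)) /\ B X (range V).

(* f is a function of the positive integers, hence the bound f n.+1 for the
   index n; its value at 0 is irrelevant. *)
Definition Usel (f : nat -> nat) (A B : cover_type) (X : topologicalType) :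
    Prop :=
  forall UU : nat -> set (set X),
    (forall n, A X (UU n)) -> (forall n, ~ has_finite_subcover (UU n)) ->
    exists F : nat -> set (set X),
      (forall n, F n `<=` UU n /\ F n #<= `I_(f n.+1)) /\
      B X (range (fun n => \bigcup_(V in F n) V)).

(* Main.v *)
Require Import Defs.
From mathcomp Require Import all_boot all_order.
From mathcomp Require Import all_classical.
From mathcomp Require Import topology cantor.
From mathcomp Require Import zify.

(** The proof constructs S' by recursion along the well order of the index set
of the scale, which by b = c has the length of the continuum. It rests on one
observation: since fewer than c functions are always bounded, the point chosen
at stage i can be made so sparse that its enumeration dominates any functions
attached to the stages up to i ([dominating_hitting_family]). Such functions
may even depend on the points chosen earlier. The hypothesis on S enters
through two facts: S has cardinality c ([refinement_card]), and an index set of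
that size carries a well order with small initial segments.

Positive part. Attaching all functions to the stages makes S' strongly
dominating: for every g, all but fewer than c points of S' dominate g. For each
n, choose n consecutive intervals and n members of the n-th gamma-cover, the
i-th of which contains every point that misses the i-th interval; this is
possible because a gamma-cover of S' u Fin has members that contain all subsets
of a given finite set. A point having fewer than n elements below the last
endpoint misses one of the n intervals ([missed_interval]), and a point that
dominates the sequence of last endpoints does so for almost all n, as does every
finite set. There remain fewer than c points, and by b = c one further member of
each cover takes care of them: n + 1 members at index n in all, which is what
the identity function permits ([Usel_id_dominating]).

Negative part. Split N into infinitely many infinite levels and let the n-th
cover consist of the sets of points that omit v, for v of level n. These are
gamma-covers as soon as each point of S' is finite on each level. Choosing k
members of each cover amounts to choosing a set of k numbers on each level, and
a point containing infinitely many of these sets defeats the choice. There are c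
many choices, so each can be assigned to a stage, whose point is taken to be a
sparse union of the chosen sets ([sparse_hitting_set], [not_Usel_const]).

Rothberger part. Clopen subsets of the Cantor space have countably many codes,
so there are only c many sequences of families of clopen sets, and each is
assigned to a stage i. Let Y be the set of points chosen before i. If the
families omega-cover Y u Fin, then, as Y has fewer than p = c points, a
pseudointersection yields members almost all of which contain any given point of
Y u Fin, and thinning them out gives successive intervals such that a point
missing the interval of a member belongs to that member. Any finitely many
points that dominate a suitable g miss a common interval. So it is enough that
all the points chosen from stage i on dominate g ([omega_selection_exists]),
and g may be attached to stage i since it depends only on Y. *)

Set Implicit Arguments.
Unset Strict Implicit.
Unset Printing Implicit Defensive.

Local Open Scope classical_set_scope.
Local Open Scope card_scope.
Local Open Scope nat_scope.

(** * Sets with fewer than continuum many elements *)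

(** The negative form avoids comparability of cardinals, and it is the form
in which the minimality of b and p is used. *)
Definition small (T : Type) (A : set T) : Prop := ~ ([set: nat -> bool] #<= A).

Lemma card_le_injP (T U : Type) (B : set U) :
  [set: T] #<= B <-> exists f : T -> U, injective f /\ forall x, B (f x).
Proof.
split=> [|[f [finj fB]]].
  elim/Pchoice: U => U in B *; move=> /card_leP[f].
  pose g x := set_val (f (to_setT x)).
  exists g; split=> [x y /val_inj fxy|x]; last exact: set_mem (valP (f _)).
  have e : to_setT x = to_setT y by apply: 'inj_f fxy; exact: mem_set.
  exact: (congr1 set_val e).
apply: (@card_le_trans _ _ _ (f @` setT)); last first.
  by apply: subset_card_le => _ [x _ <-].
have /card_eqPle[] // : f @` setT #= [set: T].
by apply: inj_card_eq => x y _ _; exact: finj.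
Qed.

Lemma small_le (T U : Type) (A : set T) (B : set U) :
  A #<= B -> small B -> small A.
Proof. by move=> AB sB CA; apply: sB; apply: card_le_trans AB. Qed.

Lemma small_image (T U : Type) (f : T -> U) (A : set T) :
  small A -> small (f @` A).
Proof. by apply: small_le; exact: card_image_le. Qed.

Lemma small_sub (T : Type) (A B : set T) : A `<=` B -> small B -> small A.
Proof. by move=> /subset_card_le; exact: small_le. Qed.

Lemma small_countable (T : Type) (A : set T) : countable A -> small A.
Proof.
move=> cA CA.
have /card_le_injP[f [finj _]] : [set: nat -> bool] #<= [set: nat].
  exact: card_le_trans cA.
(* The diagonal of an injection of the power set of nat into nat. *)
pose d n := `[< exists g, f g = n /\ ~~ g n >].
case dd: (d (f d)); move: (dd).
  by move=> /asboolP[g [/finj ->]]; rewrite dd.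
by move=> /negbT/asboolPn; apply; exists d; rewrite dd.
Qed.

(** A continuum splits into continuum many disjoint continua: either one of
them lies within A, or each of them meets B. *)
Lemma small_setU (T : Type) (A B : set T) :
  small A -> small B -> small (A `|` B).
Proof.
move=> sA sB /card_le_injP[f [finj fAB]].
pose mix (a b : nat -> bool) n := if odd n then a n./2 else b n./2.
have mixl a b a' b' : mix a b = mix a' b' -> a = a'.
  move=> e; apply/funext => n; have := congr1 (@^~ n.*2.+1) e.
  by rewrite /mix /= odd_double /= uphalf_double.
have mixr a b a' b' : mix a b = mix a' b' -> b = b'.
  move=> e; apply/funext => n; have := congr1 (@^~ n.*2) e.
  by rewrite /mix /= odd_double /= doubleK.
have [[a aA]|noA] := pselect (exists a, forall b, A (f (mix a b))).
  apply: sA; apply/card_le_injP; exists (fun b => f (mix a b)).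
  by split=> // b b' /finj/mixr.
have meetB a : exists b, B (f (mix a b)).
  apply: contrapT => nB; apply: noA; exists a => b.
  by case: (fAB (mix a b)) => // fB; case: nB; exists b.
have [b bB] := choice meetB.
apply: sB; apply/card_le_injP; exists (fun a => f (mix a (b a))).
by split=> // a a' /finj/mixl.
Qed.

(** * Eventual domination and enumerations *)

Lemma le_starP f g :
  le_star f g <-> exists N, forall n, N <= n -> f n <= g n.
Proof. by split=> [[N _ fg]|[N fg]]; exists N => // n; exact: fg. Qed.

Lemma le_star_trans f g h : le_star f g -> le_star g h -> le_star f h.
Proof.
move=> /le_starP[N fg] /le_starP[M gh]; apply/le_starP; exists (maxn N M) => n.
by rewrite geq_max => /andP[/fg fgn /gh]; exact: leq_trans.
Qed.

Lemma le_fun_star f g : (forall n, f n <= g n) -> le_star f g.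
Proof. by move=> fg; apply/le_starP; exists 0. Qed.

Lemma small_bounded : b_eq_c -> forall F : set (nat -> nat), small F ->
  exists g, forall f, F f -> le_star f g.
Proof. by move=> [_ bc] F sF; apply: contrapT => /bc. Qed.

Lemma small_dominated : b_eq_c ->
  forall (T : Type) (A : set T) (h : T -> nat -> nat), small A ->
  exists g, forall x, A x -> le_star (h x) g.
Proof.
move=> bc T A h sA; have [g hg] := small_bounded bc (small_image (f := h) sA).
by exists g => x Ax; apply: hg; exists x.
Qed.

Lemma finite_nat_bound (A : set nat) :
  finite_set A <-> exists N, forall n, A n -> n < N.
Proof.
split=> [/finite_seqP[s ->]|[N AN]]; last first.
  by apply: (sub_finite_set (B := `I_N)); [exact: AN|exact: finite_II].
exists (\max_(i <- s) i).+1 => n /= ns; rewrite ltnS.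
by rewrite (big_rem n) //= leq_maxl.
Qed.

Lemma infinite_natP (A : set nat) :
  infinite_set A <-> forall N, exists2 n, N <= n & A n.
Proof.
split=> [iA N|iA /finite_nat_bound[N AN]]; last first.
  by have [n Nn /AN] := iA N; rewrite ltnNge Nn.
apply: contrapT => noN; apply: iA; apply/finite_nat_bound; exists N => n An.
by rewrite ltnNge; apply/negP => Nn; apply: noN; exists n.
Qed.

Lemma homo_from_step (K : nat -> nat) : (forall i, K i < K i.+1) ->
  {homo K : m n / m < n}.
Proof. by move=> Kstep; apply: homo_ltn => // y x z; exact: ltn_trans. Qed.

Lemma homo_ge (e : nat -> nat) :
  {homo e : m n / m < n} -> forall n, n <= e n.
Proof. by move=> ehomo; elim=> // n /leq_ltn_trans; apply; exact: ehomo. Qed.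

Lemma enum_ofP (a : cantor_space) : infsets a ->
  {homo enum_of a : m n / m < n} /\ range (enum_of a) = supp a.
Proof.
move=> ia; suff ex : exists e, {homo e : m n / m < n} /\ range e = supp a.
  by rewrite /enum_of; case: xgetP => [e _ //|noe]; case: ex => e /noe.
have /choice[next nextP] N : exists m,
    [/\ N <= m, supp a m & forall n, N <= n -> supp a n -> m <= n].
  have ex : exists n, (N <= n) && `[< supp a n >].
    by have /infinite_natP/(_ N)[n Nn an] := ia; exists n; rewrite Nn; apply/asboolP.
  exists (ex_minn ex); case: ex_minnP => m /andP[Nm /asboolP am] mmin.
  by split=> // n Nn an; apply: mmin; rewrite Nn; apply/asboolP.
pose e := fix e n := if n is n'.+1 then next (e n').+1 else next 0.
have emono : {homo e : m n / m < n}.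
  by apply: homo_from_step => n /=; case: (nextP (e n).+1).
have esupp n : supp a (e n).
  by case: n => [|n] /=; [case: (nextP 0)|case: (nextP (e n).+1)].
exists e; split=> //; apply/seteqP; split=> [_ [n _ <-]|m am]; first exact: esupp.
apply: contrapT => mNe.
suff lem n : e n < m by have := lem m; rewrite ltnNge homo_ge.
have neq k : e k != m by apply/eqP => ekm; apply: mNe; exists k.
by elim: n => [|n IH]; rewrite ltn_neqAle neq /=;
  [case: (nextP 0)|case: (nextP (e n).+1)] => _ _; apply.
Qed.

Definition misses (a : cantor_space) m n :=
  forall i, m <= i < n -> ~~ (a : nat -> bool) i.

Lemma supp_enum_of (a : cantor_space) v : infsets a -> supp a v ->
  exists i, enum_of a i = v.
Proof. by move=> /enum_ofP[_ <-] [i _ <-]; exists i. Qed.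

Lemma enum_of_lt (a : cantor_space) i j : infsets a ->
  enum_of a i < enum_of a j -> i < j.
Proof.
move=> /enum_ofP[emono _]; apply: contraTT; rewrite -!leqNgt leq_eqVlt.
by move=> /predU1P[->//|/emono/ltnW].
Qed.

Lemma enum_of_inj (a : cantor_space) : infsets a -> injective (enum_of a).
Proof.
move=> /enum_ofP[emono _] i j eij; case: (ltngtP i j) => // /emono;
  by rewrite eij ltnn.
Qed.

(** Pigeonhole: below the endpoint of the last of the q intervals each of the
points has at most j elements, which together are too few to meet q disjoint
intervals. *)
Lemma missed_interval (ys : seq cantor_space) (k : nat -> nat) (j i0 q : nat) :
  {homo k : m n / m < n} ->
  (forall y, y \in ys -> infsets y /\ k (i0 + q) <= enum_of y j) ->
  size ys * j < q ->
  exists i, i0 <= i < i0 + q /\ forall y, y \in ys -> misses y (k i) (k i.+1).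
Proof.
move=> kmono ysP; apply: contraTP => noi; rewrite -leqNgt.
have hit i : exists v, i0 <= i < i0 + q -> k i <= v < k i.+1 /\
    exists y, y \in ys /\ supp y v.
  have [iq|iq] := boolP (i0 <= i < i0 + q); last by exists 0.
  apply: contrapT => nov; apply: noi; exists i; split=> // y yys v vi.
  by apply/negP => yv; apply: nov; exists v => _; split=> //; exists y.
have [c cP] := choice hit.
pose E := [seq enum_of y l | y <- ys, l <- iota 0 j].
suff : size [seq c i | i <- iota i0 q] <= size E.
  by rewrite size_map size_iota size_allpairs size_iota.
have kle : {homo k : m n / m <= n}.
  by move=> m n; rewrite leq_eqVlt => /predU1P[->//|/kmono/ltnW].
apply: uniq_leq_size.
  rewrite map_inj_in_uniq ?iota_uniq // => m n; rewrite !mem_iota => mq nq.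
  have [/andP[m1 m2] _] := cP _ mq; have [/andP[n1 n2] _] := cP _ nq.
  case: (ltngtP m n) => // [/kle|/kle] h e.
    by have := leq_trans h n1; rewrite -e leqNgt m2.
  by have := leq_trans h m1; rewrite e leqNgt n2.
move=> v /mapP[i]; rewrite mem_iota => iq -> {v}.
have [/andP[_ ci] [y [yys yci]]] := cP _ iq; have [iy ky] := ysP _ yys.
have [l el] := supp_enum_of iy yci.
apply/allpairsP; exists (y, l); split=> //=; rewrite mem_iota add0n /=.
apply: (enum_of_lt iy); rewrite el; apply: leq_trans ky; apply: leq_trans ci _.
by apply: kle; case/andP: iq.
Qed.

(** * Sparse sets that contain prescribed blocks *)

(** The 2-adic valuation of v + 1 partitions the numbers into infinitely many
infinite levels such that every number is at least its level. *)
Definition level (v : nat) : nat := logn 2 v.+1.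

Lemma level_le v : level v <= v.
Proof. by rewrite -ltnS ltn_logl. Qed.

Lemma level_infinite n : infinite_set [set v | level v = n].
Proof.
apply/infinite_natP => N; exists (2 ^ n * N.*2.+1).-1.
  rewrite -ltnS prednK ?muln_gt0 ?expn_gt0 //.
  by rewrite (leq_trans _ (leq_pmull _ _)) ?expn_gt0 // -addnn ltnS leq_addr.
rewrite /= /level prednK ?muln_gt0 ?expn_gt0 //.
rewrite lognM ?expn_gt0 // pfactorK // lognE /= dvdn2 /= odd_double /=.
by rewrite addn0.
Qed.

(** The size bound k is what makes a union of few blocks sparse; the last
condition makes a union of far away blocks finite on each level. *)
Definition block_seq (k : nat) (D : nat -> seq nat) : Prop :=
  [/\ forall i, size (D i) <= k, forall i, D i <> [::] &
      forall i v, v \in D i -> i <= level v].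

Definition hits (D : nat -> seq nat) (y : cantor_space) : Prop :=
  infinite_set [set i | forall v, v \in D i -> supp y v].

Lemma size_flatten_le (T : Type) (k : nat) (D : nat -> seq T) (s : seq nat) :
  (forall i, size (D i) <= k) -> size (flatten [seq D i | i <- s]) <= size s * k.
Proof.
move=> Dk; elim: s => //= i s IH; rewrite size_cat mulSn.
exact: leq_add.
Qed.

(** The union of the blocks D (p i) for a fast growing p. If its j-th element
were below f j, then the j + 1 elements up to it would lie in the first j / k
blocks, as the later blocks lie above f j; but these have at most j elements. *)
Lemma sparse_hitting_set (f : nat -> nat) (D : nat -> seq nat) (k : nat) :
  block_seq k D ->
  exists t : cantor_space,
    [/\ infsets t, le_star f (enum_of t),
        forall n, finite_set [set v | supp t v /\ level v = n] &
        hits D t].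
Proof.
move=> [Dk D0 Dlev].
have k0 : 0 < k.
  by have := Dk 0; have := D0 0; case: (D 0) => // v s _; exact: leq_trans.
(* f need not be monotone: p i bounds all values f j with j <= k * i.+1. *)
pose p i := i + \sum_(j < (k * i.+1).+1) f j.
have pge i j : j <= k * i.+1 -> f j <= p i.
  rewrite -ltnS => jk; apply: leq_trans (leq_addl _ _).
  by rewrite (bigD1 (Ordinal jk)) //= leq_addr.
have ple i : i <= p i by exact: leq_addr.
pose t : cantor_space := fun v => `[< exists i, v \in D (p i) >].
have tP v : supp t v <-> exists i, v \in D (p i).
  by split => [/asboolP|?] //; apply/asboolP.
have it : infsets t.
  apply/infinite_natP => N; case DN: (D (p N)) => [|v s]; first by case: (D0 (p N)).
  have vD : v \in D (p N) by rewrite DN mem_head.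
  exists v; last by apply/tP; exists N.
  exact: leq_trans (ple N) (leq_trans (Dlev _ _ vD) (level_le v)).
exists t; split=> //.
- apply: le_fun_star => j; rewrite leqNgt; apply/negP => ltf.
  have [emono et] := enum_ofP it.
  pose L := flatten [seq D (p i) | i <- iota 0 (j %/ k)].
  suff : size [seq enum_of t l | l <- iota 0 j.+1] <= size L.
    rewrite size_map size_iota ltnNge => /negP; apply.
    apply: leq_trans (size_flatten_le _ _) _ => [i|]; first exact: Dk.
    by rewrite size_iota leq_trunc_div.
  apply: uniq_leq_size.
    by rewrite map_inj_in_uniq ?iota_uniq // => m n _ _; exact: enum_of_inj.
  move=> v /mapP[l]; rewrite mem_iota add0n /= => lj vl.
  have /tP[i vi] : supp t v by rewrite vl -et; exists l.
  have lev : v <= enum_of t j.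
    by rewrite vl; move: lj; rewrite ltnS leq_eqVlt => /predU1P[->//|/emono/ltnW].
  apply/flattenP; exists (D (p i)) => //; apply/mapP; exists i => //.
  rewrite mem_iota add0n /= ltnNge; apply/negP => ji.
  have := pge i j; rewrite (leqNgt (f j)) => /(_ _)/negP; apply.
    by apply: ltnW; rewrite mulnC -ltn_divLR // ltnS.
  apply: leq_ltn_trans ltf; apply: leq_trans lev.
  exact: leq_trans (Dlev _ _ vi) (level_le v).
- move=> n; pose L := flatten [seq D (p i) | i <- iota 0 n.+1].
  apply: (@sub_finite_set _ _ [set` L]).
    move=> v [/tP[i vi] lv]; suff : v \in L by [].
    apply/flattenP; exists (D (p i)) => //.
    apply/mapP; exists i => //; rewrite mem_iota add0n ltnS -lv /=.
    exact: leq_trans (ple i) (Dlev _ _ vi).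
  exact: finite_seq.
- by apply/infinite_natP => N; exists (p N) => //= v vD; apply/tP; exists N.
Qed.

(** When D is not a sequence of blocks, any block sequence will do in its
place; this makes the lemma applicable to an enumeration of all D. *)
Lemma sparse_point (f : nat -> nat) (D : nat -> seq nat) :
  exists t : cantor_space,
    [/\ infsets t, le_star f (enum_of t),
        forall n, finite_set [set v | supp t v /\ level v = n] &
        forall k, block_seq k D -> hits D t].
Proof.
have [[k Dk]|noD] := pselect (exists k, block_seq k D).
  by have [t [*]] := sparse_hitting_set f Dk; exists t.
have /choice[v vP] n : exists v, level v = n.
  by have [v] := infinite_setN0 (level_infinite (n := n)); exists v.
have [|t [*]] := @sparse_hitting_set f (fun n => [:: v n]) 1.
  by split=> // i w; rewrite inE => /eqP ->; rewrite vP.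
by exists t; split=> // k Dk; case: noD; exists k.
Qed.

(** * Open sets and finite prefixes *)

(** Otherwise there are points outside V that agree with x on longer and longer
prefixes; they converge to x. *)
Lemma nbhs_prefix (x : cantor_space) (V : set cantor_space) :
  open V -> V x ->
  exists l, forall y : cantor_space, (forall i, i < l -> y i = x i) -> V y.
Proof.
move=> oV Vx; apply: contrapT => nol.
have /choice[y yP] l : exists y : cantor_space,
    (forall i, i < l -> y i = x i) /\ ~ V y.
  apply: contrapT => noy; apply: nol; exists l => y yx.
  by apply: contrapT => nVy; apply: noy; exists y.
have ycvg : y @ \oo --> x.
  apply/cvg_sup => N U [V'] [[W] oW <-] WxN WU.
  apply: (filterS WU); rewrite nbhs_simpl; exists N.+1 => // i /= iN.
  by have [yx _] := yP i; rewrite /= /proj yx.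
have [N _ /(_ N (leqnn N))] : nbhs (y @ \oo) V by apply: ycvg; exact: open_nbhs_nbhs.
by case: (yP N).
Qed.

Lemma open_coordinate (v : nat) (b : bool) :
  open [set x : cantor_space | (x : nat -> bool) v = b].
Proof.
have -> : [set x : cantor_space | (x : nat -> bool) v = b] =
  (@proj nat (fun=> bool) v) @^-1` [set b] by [].
by apply: open_comp; [move=> ? _; exact: proj_continuous|exact: discrete_open].
Qed.

Lemma subspace_prefix (A : set cantor_space) (U : set A) (x : A) :
  open U -> U x ->
  exists l, forall y : A, (forall i, i < l -> set_val y i = set_val x i) -> U y.
Proof.
move=> [V oV <-] Vx; have [l lV] := nbhs_prefix oV Vx.
by exists l => y yx; exact: lV.
Qed.

Definition below (k : nat) : set cantor_space :=
  [set a | forall i, k <= i -> (a : nat -> bool) i = false].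

Lemma finite_below k : finite_set (below k).
Proof.
apply: (@sub_finite_set _ _
  ((fun s : k.-tuple bool => (fun i => nth false s i) : cantor_space) @` setT)).
  move=> a ak; exists [tuple of mkseq (a : nat -> bool) k] => //.
  apply/funext => i /=; have [ki|ik] := leqP k i; last by rewrite nth_mkseq.
  by rewrite nth_default ?size_mkseq //; exact/esym/ak.
by apply: finite_image; exact: finite_finset.
Qed.

Lemma below_Fin k : below k `<=` Fin.
Proof.
move=> a ak; apply/finite_nat_bound; exists k => n; rewrite ltnNge => an.
by apply/negP => /ak; move: an => /= ->.
Qed.

Definition trunc (a : cantor_space) (k : nat) : cantor_space :=
  fun i => (i < k) && (a : nat -> bool) i.

Lemma trunc_below a k : below k (trunc a k).
Proof. by move=> i; rewrite /trunc leqNgt => /negbTE ->. Qed.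

Lemma misses_trunc (a : cantor_space) k k' : misses a k k' ->
  forall i, i < k' -> (a : nat -> bool) i = trunc a k i.
Proof.
move=> ak i ik'; rewrite /trunc; case: (ltnP i k) => //= ki.
by apply/negbTE/ak; rewrite ki.
Qed.

Lemma finite_set_bound (T : Type) (F : set T) (P : T -> nat -> Prop) :
  finite_set F -> (forall x, F x -> exists N, forall n, N <= n -> P x n) ->
  exists N, forall n, N <= n -> forall x, F x -> P x n.
Proof.
move=> finF PF.
have /choice[b bP] x : exists N, F x -> forall n, N <= n -> P x n.
  by have [/PF[N NP]|nFx] := pselect (F x); [exists N|exists 0].
have /finite_nat_bound[N NP] := finite_image b finF.
exists N => n Nn x Fx; apply: bP => //; apply: leq_trans Nn; apply: ltnW.
by apply: NP; exists x.
Qed.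

(** There are only finitely many subsets of {0, ..., k - 1}, and each has a
neighbourhood within U determined by a prefix. A point missing a long enough
interval after k agrees with its truncation at k on all these prefixes. *)
Lemma open_gap (A : set cantor_space) (U : set A) (k : nat) :
  Fin `<=` A -> open U -> (forall x : A, below k (set_val x) -> U x) ->
  exists2 k', k < k' & forall x : A, misses (set_val x) k k' -> U x.
Proof.
move=> FA oU kU.
have [N NP] : exists N, forall n, N <= n -> forall s, below k s ->
    forall x : A, (forall i, i < n -> (set_val x : nat -> bool) i = s i) -> U x.
  apply: finite_set_bound (finite_below k) _ => s sk.
  have sA : s \in A by apply/mem_set/FA; exact: below_Fin sk.
  have [l lU] := subspace_prefix oU (kU (exist _ s sA) sk).
  by exists l => n ln x xs; apply: lU => i il; apply: xs; exact: leq_trans ln.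
exists (maxn N k.+1); first by rewrite leq_max leqnn orbT.
move=> x xk; apply: (NP (maxn N k.+1) (leq_maxl _ _) (trunc (set_val x) k)).
  exact: trunc_below.
exact: misses_trunc.
Qed.

(** * The identity selection property of strongly dominating sets *)

Lemma Gamma_seq (X : topologicalType) (UU : set (set X)) : Gamma UU ->
  exists W : nat -> set X, [/\ forall m, UU (W m), injective W &
    forall x, exists M, forall m, M <= m -> W m x].
Proof.
move=> [_ /infiniteP/card_le_injP[W [Winj WU]] Ufin]; exists W; split=> // x.
have /finite_nat_bound[M MP] : finite_set (W @^-1` [set V | UU V /\ ~ V x]).
  by apply: finite_preimage => //; apply: in2W.
exists M => m Mm; apply: contrapT => nW.
by have := MP m (conj (WU m) nW); rewrite ltnNge Mm.
Qed.

(** That the range is infinite comes for free: each of finitely many sets V m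
omits some point, while for large n the set V n contains all these points. *)
Lemma Gamma_range (X : topologicalType) (V : nat -> set X) :
  (forall n, open (V n)) -> (forall n, V n <> setT) ->
  (forall x, exists N, forall n, N <= n -> V n x) -> Gamma (range V).
Proof.
move=> oV VT Vev; split.
- split; last by move=> _ [n _ <-].
  split; last by move=> [n _ /VT].
  apply/seteqP; split=> // x _; have [N NV] := Vev x.
  by exists (V N); [exists N|exact: NV].
- move=> finV; have /choice[x xP] n : exists x, ~ V n x.
    by apply: contrapT => nx; apply: (VT n); apply/seteqP; split=> // x _;
      apply: contrapT => nVx; apply: nx; exists x.
  have [N NP] : exists N, forall n, N <= n -> forall W, range V W ->
      exists2 y, ~ W y & V n y.
    apply: finite_set_bound finV _ => W [m _ <-]; have [N NV] := Vev (x m).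
    by exists N => n Nn; exists (x m); [exact: xP|exact: NV].
  by have [] := NP N (leqnn N) (V N) (ex_intro2 _ _ N I erefl).
- move=> x; have [N NV] := Vev x.
  apply: (@sub_finite_set _ _ (V @` `I_N)); last exact/finite_image/finite_II.
  move=> _ [[n _ <-] nV]; exists n => //=; rewrite ltnNge.
  by apply/negP => /NV.
Qed.

Definition strongly_dominating (S : set cantor_space) : Prop :=
  forall g, small [set y | S y /\ ~ le_star g (enum_of y)].

(** At index n, the n sets attached to n intervals contain all points that
dominate the last endpoints and all finite points; the set W n (H n) contains
the remaining, fewer than c, points from some index on. The domination bound g
is fixed before the remaining points are known, and H after. *)
Lemma Usel_id_dominating (S : set cantor_space) : b_eq_c -> S `<=` infsets ->
  strongly_dominating S -> Usel id Gamma Gamma (set_type (S `|` Fin)).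
Proof.
move=> bc Sinf Sdom UU UG UnoF; set X := set_type _ in UU UG UnoF *.
have /choice[W WP] n := Gamma_seq (UG n).
have oW n m : open (W n m).
  by case: (UG n) => -[_ Uo] _ _; apply: Uo; case: (WP n).
have /choice[h hP] (y : X) :
    exists h : nat -> nat, forall n m, h n <= m -> W n m y.
  have /choice[f fP] n : exists M, forall m, M <= m -> W n m y by case: (WP n).
  by exists f.
have /choice[step stepP] (nk : nat * nat) : exists mk : nat * nat, nk.2 < mk.2 /\
    forall x : X, misses (set_val x) nk.2 mk.2 -> W nk.1 mk.1 x.
  case: nk => n k /=.
  have finB : finite_set [set x : X | below k (set_val x)].
    by apply: finite_preimage (finite_below k) => x y _ _; exact: val_inj.
  have [m mP] := finite_set_bound (P := fun x m => W n m x) finB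
    (fun x _ => let: And3 _ _ H := WP n in H x).
  have [|k' kk' k'P] := open_gap (k := k) _ (oW n m) (mP m (leqnn m)).
    by move=> x; right.
  by exists (m, k').
pose K n := fix K i := if i is i'.+1 then (step (n, K i')).2 else 0.
have Kmono n : {homo K n : i j / i < j}.
  by apply: homo_from_step => i; case: (stepP (n, K n i)).
pose m n i := (step (n, K n i)).1.
have gapP n i (x : X) : misses (set_val x) (K n i) (K n i.+1) -> W n (m n i) x.
  by case: (stepP (n, K n i)) => _; apply.
(* The points with g j <= enum_of y j have at most j elements below K n n for
   n = j.+1, so they miss one of the n intervals. *)
pose g j := K j.+1 j.+1.
pose Y := [set x : X | S (set_val x) /\ ~ le_star g (enum_of (set_val x))].
have sY : small Y.
  apply: small_le (Sdom g).
  apply: card_le_trans (subset_card_le (A := set_val @` Y) _).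
    have /card_eqPle[] // : set_val @` Y #= Y.
    by apply: inj_card_eq => x y _ _; exact: val_inj.
  by move=> _ [x Yx <-].
have [H HP] := small_dominated bc h sY.
pose sel n i := if i < n then W n (m n i) else W n (H n).
exists (fun n => sel n @` `I_n.+1); split.
  move=> n; split; last exact: card_image_le.
  by move=> _ [i _ <-]; rewrite /sel; case: ifP => _; case: (WP n).
apply: Gamma_range => [n|n|x].
- by apply: bigcup_open => _ [i _ <-]; rewrite /sel; case: ifP.
- move=> selT; apply: (UnoF n); exists (sel n @` `I_n.+1); split.
  + by move=> _ [i _ <-]; rewrite /sel; case: ifP => _; case: (WP n).
  + exact/finite_image/finite_II.
  + split=> // -[i _]; case: (UG n) => -[[_ UT] _] _ _ selnT; apply: UT.
    by rewrite -selnT /sel; case: ifP => _; case: (WP n).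
have gap_sel n i : i < n -> misses (set_val x) (K n i) (K n i.+1) ->
    (\bigcup_(V in sel n @` `I_n.+1) V) x.
  move=> ni /gapP Wx; exists (W n (m n i)) => //; exists i => /=.
    exact: ltnW.
  by rewrite /sel ni.
have [Sx|Fx] : S (set_val x) \/ Fin (set_val x) by exact: set_mem (valP x).
- have [/le_starP[N NP]|ndom] := pselect (le_star g (enum_of (set_val x))).
    exists N.+1 => -[//|n] Nn.
    have [|//|i [/andP[_ ni] ix]] :=
      missed_interval (ys := [:: set_val x]) (j := n) (i0 := 0) (q := n.+1)
        (Kmono n.+1).
    + by move=> y; rewrite inE => /eqP ->; split; [exact: Sinf|exact: NP].
    + by rewrite mul1n.
    + by apply: gap_sel ni _; apply: ix; rewrite inE.
  have /le_starP[N NP] := HP x (conj Sx ndom).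
  exists N => n Nn; exists (W n (H n)); last exact: hP (NP _ Nn).
  by exists n => //=; rewrite /sel ltnn.
- (* A finite point misses the N-th interval, which lies above it. *)
  have /finite_nat_bound[N NP] := Fx.
  exists N.+1 => n Nn; apply: (gap_sel n N) => // i /andP[Ki _].
  apply/negP => /NP; rewrite ltnNge => /negP; apply.
  exact: leq_trans (homo_ge (Kmono n) N) Ki.
Qed.

(** * Failure of the constant selection properties *)

Definition finset_pt (s : seq nat) : cantor_space := fun v => v \in s.

Lemma finset_pt_Fin s : Fin (finset_pt s).
Proof. exact: finite_seq. Qed.

Definition avoid (A : set cantor_space) (v : nat) : set A :=
  [set x | (set_val x : nat -> bool) v = false].

Lemma finite_image_seq (U : Type) (O : nat -> U) (B : set U) (k : nat) :
  B `<=` range O -> B #<= `I_k ->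
  exists2 s : seq nat, size s <= k & B = O @` [set` s].
Proof.
move=> BO /pfcard_geP[->|[f]].
  by exists [::] => //; apply/seteqP; split=> // V [v].
have fB i : i < k -> B (f i) by exact: 'funS_f.
have /choice[v vP] i : exists v, i < k -> O v = f i.
  have [/fB/BO[v _ e]|_] := ltnP i k; first by exists v.
  by exists 0.
exists [seq v i | i <- iota 0 k]; first by rewrite size_map size_iota.
apply/seteqP; split=> [V FV|V [w /= /mapP[i ik ->] <-{V}]].
  have [i ik <-] := 'surj_f FV.
  by exists (v i); [apply/mapP; exists i; rewrite ?mem_iota|exact: vP].
by move: ik; rewrite mem_iota add0n /= => ik; rewrite vP //; exact: fB.
Qed.

(** A selection of at most k members from each of the covers is described by
lists a n of at most k numbers of level n, and the union of the members selected
at n omits exactly the points that contain a n. Selections may be empty for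
many n; only the nonempty ones form the blocks that a point of S contains
infinitely often. *)
Lemma not_Usel_const (S : set cantor_space) (k : nat) :
  (forall y, S y -> forall n, finite_set [set v | supp y v /\ level v = n]) ->
  (forall D, block_seq k D -> exists2 y, S y & hits D y) ->
  ~ Usel (fun=> k) Gamma Gamma (set_type (S `|` Fin)).
Proof.
move=> Slev Shits.
pose A := S `|` Fin; pose O v : set A := @avoid A v.
have ptA s : finset_pt s \in A by apply/mem_set; right; exact: finset_pt_Fin.
pose pt s : A := exist _ (finset_pt s) (ptA s).
have Opt s v : O v (pt s) <-> v \notin s.
  by split=> [h|/negbTE h]; [exact/negbT/h|exact: h].
have Oinj : injective O.
  move=> v w e; have : ~ O v (pt [:: v]) by move=> /Opt; rewrite inE eqxx.
  by rewrite e => nO; apply: contrapT => vw; apply: nO; apply/Opt;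
    rewrite inE eq_sym; apply/eqP.
pose UU n := O @` [set v | level v = n].
have UG n : Gamma (UU n).
  have xfin (x : A) : finite_set [set v | supp (set_val x) v /\ level v = n].
    have [Sx|Fx] : A (set_val x) by exact: set_mem (valP x).
      exact: Slev.
    by apply: sub_finite_set Fx => v [].
  split.
  - split; last first.
      move=> _ [v _ <-].
      exists [set x : cantor_space | (x : nat -> bool) v = false] => //.
      exact: open_coordinate.
    split; last by move=> [v _ OT]; have : O v (pt [:: v]) by [rewrite OT];
      move=> /Opt; rewrite inE eqxx.
    apply/seteqP; split=> // x _; apply: contrapT => nx.
    apply: (level_infinite (n := n)).
    apply: sub_finite_set (xfin x) => v vn; split=> //.
    apply: contrapT => nv; apply: nx.
    by exists (O v); [exists v|exact/negbTE/negP].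
  - apply/infiniteP/card_le_trans; first exact/infiniteP/(level_infinite (n := n)).
    have /card_eqPle[] // : UU n #= [set v | level v = n].
    by apply: inj_card_eq; exact: in2W.
  - move=> x; apply: sub_finite_set (finite_image O (xfin x)).
    move=> _ [[v vn <-] nO]; exists v => //; split=> //.
    by apply: contrapT => nv; apply: nO; exact/negbTE/negP.
have UnoF n : ~ has_finite_subcover (UU n).
  move=> [F [FU finF [FT _]]].
  have /choice[v vP] V : exists v, F V -> V = O v.
    by have [/FU[v _ <-]|] := pselect (F V); [exists v|exists 0].
  have [s sP] := (finite_seqP (v @` F)).1 (finite_image v finF).
  have [V FV] : (\bigcup_(V in F) V) (pt s) by rewrite FT.
  rewrite (vP V FV) => /Opt/negP; apply.
  by have : [set` s] (v V) by rewrite -sP; exists V.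
move=> /(_ UU UG UnoF)[F [FP [_ Finf Fev]]].
have /choice[a aP] n : exists s : seq nat, size s <= k /\ F n = O @` [set` s].
  have [FU Fk] := FP n.
  have [|s] := finite_image_seq (O := O) _ Fk; last by exists s.
  by move=> V /FU[v _ <-]; exists v.
have alev n v : v \in a n -> level v = n.
  move=> va; have [FU _] := FP n; have [_ Fa] := aP n.
  have : F n (O v) by rewrite Fa; exists v.
  by move=> /FU[w wn /Oinj <-].
pose W n := \bigcup_(V in F n) V.
have Wpt n s : W n (pt s) <-> exists2 v, v \in a n & v \notin s.
  rewrite /W; have [_ ->] := aP n; split=> [[_ [v va <-] /Opt]|[v va /Opt]].
    by exists v.
  by exists (O v) => //; exists v.
have /choice[j jP] i : exists n, i <= n /\ a n <> [::].
  (* Otherwise all but finitely many of the unions are empty. *)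
  apply: contrapT => noj; apply: Finf.
  apply: (@sub_finite_set _ _ (W @` `I_i `|` [set set0])).
    move=> _ [n _ <-]; have [ni|ni] := ltnP n i; first by left; exists n.
    right; have an : a n = [::] by apply: contrapT => an; apply: noj; exists n.
    apply/seteqP; split=> // x [V + _]; have [_ ->] := aP n.
    by rewrite an => -[].
  by rewrite finite_setU; split=> //; exact/finite_image/finite_II.
have [|y Sy yinf] := Shits (a \o j).
  split=> [i|i|i v /alev ->]; first by case: (aP (j i)).
    by case: (jP i).
  by case: (jP i).
have yA : y \in A by apply/mem_set; left.
pose x : A := exist _ y yA.
pose J := [set n | a n <> [::] /\ forall v, v \in a n -> supp y v].
have Jinf : infinite_set J.
  apply/infinite_natP => N; have /infinite_natP/(_ N)[i Ni iy] := yinf.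
  by have [ij aj] := jP i; exists (j i); [exact: leq_trans ij|split].
(* Nonempty lists of different levels are disjoint, so the finite point a n
   separates W n from W m. *)
have Winj : {in J &, injective W}.
  move=> n m /set_mem[an _] /set_mem[am _] Wnm.
  case am': (a m) am => [//|v s] _; have vam : v \in a m by rewrite am' mem_head.
  apply: contrapT => nm; have : W m (pt (a n)).
    apply/Wpt; exists v => //; apply/negP => /alev vn; apply: nm.
    by rewrite -vn (alev _ _ vam).
  by rewrite -Wnm => /Wpt[w wn]; rewrite wn.
apply: Jinf; have := Fev x => finE.
have : finite_set (W @` J).
  apply: sub_finite_set finE => _ [n [_ ny] <-]; split; first by exists n.
  move=> [V]; have [_ ->] := aP n => -[v van <-].
  by move=> /(elimF idP); apply; exact: ny.
by rewrite (eq_finite_set (inj_card_eq Winj)).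
Qed.

(** * Omega-covers and clopen sets *)

(** The clopen set of all points having one of the listed prefixes. Its codes
form a countable type, which makes sequences of families of clopen sets
enumerable by the continuum. *)
Definition clopen_of (w : seq (seq bool)) : set cantor_space :=
  [set x | has (fun s => mkseq (x : nat -> bool) (size s) == s) w].

Definition clopen_depth (w : seq (seq bool)) : nat := \max_(s <- w) size s.

Lemma clopen_of_prefix w l (x y : cantor_space) : clopen_depth w <= l ->
  (forall i, i < l -> (x : nat -> bool) i = (y : nat -> bool) i) ->
  clopen_of w x -> clopen_of w y.
Proof.
move=> wl xy /hasP[s sw /eqP xs]; apply/hasP; exists s => //; rewrite -{2}xs.
apply/eqP/eq_in_map => i; rewrite mem_iota add0n /= => il; apply/esym/xy.
apply: leq_trans il (leq_trans _ wl).
by rewrite /clopen_depth (big_rem s) //= leq_maxl.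
Qed.

(** A finite set lies within an open set together with a clopen neighbourhood,
so every open omega-cover is refined by the omega-family of all codes of clopen
sets that are contained in one of its members. *)
Lemma Omega_clopen (A : set cantor_space) (UU : set (set A)) (F : set cantor_space) :
  Omega UU -> finite_set F -> F `<=` A ->
  exists w, (exists2 V, UU V & forall x : A, clopen_of w (set_val x) -> V x) /\
    F `<=` clopen_of w.
Proof.
move=> [[_ Uo] UO] finF FA.
have [|V UV FV] := UO (set_val @^-1` F).
  by apply: finite_preimage finF => x y _ _; exact: val_inj.
have [l lP] : exists l, forall n, l <= n -> forall x, F x ->
    forall y : A, (forall i, i < n ->
      (set_val y : nat -> bool) i = (x : nat -> bool) i) -> V y.
  apply: finite_set_bound finF _ => x Fx; have xA : x \in A by exact/mem_set/FA.
  have [l lV] := subspace_prefix (Uo _ UV) (FV (exist _ x xA) Fx).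
  by exists l => n ln y yx; apply: lV => i il; apply: yx; exact: leq_trans ln.
have [s Fs] := (finite_seqP F).1 finF.
exists [seq mkseq (x : nat -> bool) l | x : cantor_space <- s]; split.
  exists V => // y /hasP[_ /mapP[x xs ->] /eqP]; rewrite size_mkseq => e.
  apply: (lP l (leqnn l) x); first by rewrite Fs.
  by move=> i il; have := congr1 (nth false ^~ i) e; rewrite !nth_mkseq.
rewrite Fs => x /= xs; apply/hasP; exists (mkseq (x : nat -> bool) l).
  by apply/mapP; exists x.
by rewrite size_mkseq.
Qed.

(** Z is a sequence of families of codes: (n, w) in Z means that w belongs to
the n-th family. *)
Definition omega_family (A : set cantor_space) (Z : set (nat * seq (seq bool))) :=
  forall n (F : set cantor_space), finite_set F -> F `<=` A ->
  exists2 w, Z (n, w) & F `<=` clopen_of w.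

Definition omega_selection (A : set cantor_space)
    (Z : set (nat * seq (seq bool))) (w : nat -> seq (seq bool)) :=
  (forall n, Z (n, w n)) /\
  forall F : set cantor_space, finite_set F -> F `<=` A ->
  exists n, F `<=` clopen_of (w n).

Lemma S1_Omega_clopen (A : set cantor_space) :
  (forall Z, omega_family A Z -> exists w, omega_selection A Z w) ->
  S1 Omega Omega (set_type A).
Proof.
move=> AZ UU UO.
pose Z := [set u : nat * seq (seq bool) |
  exists2 V, UU u.1 V & forall x : A, clopen_of u.2 (set_val x) -> V x].
have [|w [Zw wF]] := AZ Z.
  move=> n F finF FA; have [w [wV Fw]] := Omega_clopen (UO n) finF FA.
  by exists w.
have /choice[V VP] n : exists V, UU n V /\ forall x : A, clopen_of (w n) (set_val x) -> V x.
  by have [V UV wV] := Zw n; exists V.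
have VO (F : set A) : finite_set F -> exists n, F `<=` V n.
  move=> finF; have [|n Fn] := wF (set_val @` F) (finite_image _ finF).
    by move=> _ [x _ <-]; exact: set_mem (valP x).
  by exists n => x Fx; have [_] := VP n; apply; apply: Fn; exists x.
exists V; split; first by move=> n; have [] := VP n.
split; last by move=> F /VO[n Fn]; exists (V n).
split; last by move=> _ [n _ <-]; have [[_ Uo] _] := UO n; apply: Uo; have [] := VP n.
split.
  apply/seteqP; split=> // x _; have [n xn] := VO [set x] (finite_set1 x).
  by exists (V n); [exists n|exact: xn].
by move=> [n _ VT]; have [[[_ nT] _] _] := UO n; apply: nT; rewrite -VT; have [] := VP n.
Qed.

Lemma countable_Fin : countable Fin.
Proof.
apply: (@card_le_trans _ _ _ (finset_pt @` setT)).
  apply: subset_card_le => a /finite_seqP[s as_]; exists s => //.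
  apply/funext => v; apply/idP/idP => [vs|av].
    by have : [set` s] v by []; rewrite -as_.
  by have : supp a v by []; rewrite as_.
by apply: card_le_trans (card_image_le _ _) _; exact: countableP.
Qed.

Lemma small_pseudointersection : p_eq_c -> forall A : set cantor_space,
  small A -> centered A -> exists p, pseudointersection A p.
Proof.
by move=> [_ pc] A sA cA; apply: contrapT => nop; apply: sA; exact: pc.
Qed.

(** Through an encoding of pairs as numbers, P is a pseudointersection of the
sets of pairs of Z whose clopen set contains x, for x in A, and of the sets of
pairs of index at least M. They form a centered family because for each large n
the n-th family has a member that contains a given finite set. *)
Lemma omega_pseudointersection (A : set cantor_space)
    (Z : set (nat * seq (seq bool))) :
  p_eq_c -> small A -> A !=set0 -> omega_family A Z ->
  exists P : set (nat * seq (seq bool)),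
  [/\ forall N, exists2 u, P u & N <= pickle u,
      forall M, exists N, forall u, P u -> N <= pickle u -> M <= u.1 &
      forall x, A x -> exists N, forall u, P u -> N <= pickle u -> Z u /\ clopen_of u.2 x].
Proof.
move=> pc sA [x0 Ax0] ZO.
pose code (B : set (nat * seq (seq bool))) : cantor_space :=
  fun i => `[< exists2 u, pickle u = i & B u >].
have codeP B i : supp (code B) i <-> exists2 u, pickle u = i & B u.
  by split => [/asboolP|?] //; apply/asboolP.
pose Ax x := [set u | Z u /\ clopen_of u.2 x].
pose BM M := [set u : nat * seq (seq bool) | M <= u.1].
pose CC := (code \o Ax) @` A `|` range (code \o BM).
have sCC : small CC.
  apply: small_setU; first exact: small_image.
  by apply/small_image/small_countable/countableP.
(* Each member of the family contains the pairs (n, w) of Z such that the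
   clopen set of w contains a certain point of A and n exceeds a certain bound. *)
have CCinf F : F `<=` CC -> finite_set F -> infinite_set (\bigcap_(a in F) supp a).
  move=> FC finF.
  have /choice[yN yNP] (a : cantor_space) : exists yN : cantor_space * nat, F a ->
      A yN.1 /\ forall u, Z u -> clopen_of u.2 yN.1 -> yN.2 <= u.1 -> supp a (pickle u).
    have [Fa|nFa] := pselect (F a); last by exists (x0, 0).
    have [[y Ay <-]|[M _ <-]] := FC a Fa.
      by exists (y, 0) => _; split=> // u Zu uy _; apply/codeP; exists u.
    by exists (x0, M) => _; split=> // u _ _ uM; apply/codeP; exists u.
  have /finite_nat_bound[N NP] : finite_set ((snd \o yN) @` F) by exact: finite_image.
  have /choice[w wP] n : exists w, Z (n, w) /\ (fst \o yN) @` F `<=` clopen_of w.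
    have [||w] := ZO n ((fst \o yN) @` F); first exact: finite_image.
      by move=> _ [a Fa <-]; have [] := yNP a Fa.
    by exists w.
  apply: (@sub_infinite_set _ (range (fun n => pickle (N + n, w (N + n))))).
    move=> _ [n _ <-] a Fa; have [_] := yNP a Fa; have [Zw wF] := wP (N + n).
    apply => //=; first by apply: wF; exists a.
    by apply: ltnW; rewrite (leq_trans _ (leq_addr _ _)) //; apply: NP; exists a.
  apply/infiniteP/card_le_injP; exists (fun n => pickle (N + n, w (N + n))).
  by split=> [n m /(pcan_inj pickleK)[/addnI]|n] //; exists n.
have cCC : centered CC.
  split=> // a Ca; rewrite /infsets /=.
  have := CCinf [set a] _ (finite_set1 a); rewrite bigcap_set1; apply.
  by move=> _ ->.
have [p [pinf pP]] := small_pseudointersection pc sCC cCC.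
have codeN B : CC (code B) -> exists N, forall i, N <= i -> supp p i ->
    exists2 u, pickle u = i & B u.
  move=> /pP/finite_nat_bound[N NP]; exists N => i Ni pi; apply/codeP.
  by apply: contrapT => ni; have := NP i (conj pi ni); rewrite ltnNge Ni.
have codeN' B : CC (code B) -> exists N, forall u, supp p (pickle u) ->
    N <= pickle u -> B u.
  move=> /codeN[N NP]; exists N => u pu Nu.
  by have [v /(pcan_inj pickleK) <-] := NP _ Nu pu.
exists [set u | supp p (pickle u)]; split.
- move=> N; have [|M MP] := @codeN (Ax x0); first by left; exists x0.
  have /infinite_natP/(_ (maxn N M))[i + pi] := pinf.
  rewrite geq_max => /andP[Ni Mi]; have [u ui _] := MP i Mi pi.
  by exists u => /=; rewrite ui.
- by move=> M; apply: (@codeN' (BM M)); right; exists M.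
- by move=> x Ax_; apply: (@codeN' (Ax x)); left; exists x.
Qed.

(** Members u i of the pseudointersection are chosen successively, u i with
an interval [K i, K i.+1[ such that every point that misses it is in the clopen
set of u i; the indices of the families used increase with i. Points of Y and
finite points are in almost all of the clopen sets. The bound g j = K (j.+1 ^ 2)
ensures that m points that dominate g meet at most m * j of the first j.+1 ^ 2
intervals, for large j, which leaves an interval, beyond any prescribed one,
that they all miss. *)
Lemma omega_selection_exists (Y : set cantor_space) (Z : set (nat * seq (seq bool))) :
  p_eq_c -> small Y -> omega_family (Y `|` Fin) Z ->
  exists g w, omega_selection
    ((Y `|` Fin) `|` [set y | infsets y /\ le_star g (enum_of y)]) Z w.
Proof.
move=> pc sY ZO; set A := Y `|` Fin in ZO *.
have sA : small A by apply: small_setU => //; exact: small_countable countable_Fin.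
have A0 : A !=set0 by exists (finset_pt [::]); right; exact: finset_pt_Fin.
have [P [Pinf Pcol PA]] := omega_pseudointersection pc sA A0 ZO.
have /choice[step stepP] k : exists uk : (nat * seq (seq bool)) * nat,
    [/\ P uk.1, Z uk.1, k <= uk.1.1 < uk.2, k <= pickle uk.1 &
        forall x, misses x k uk.2 -> clopen_of uk.1.2 x].
  have [N NP] : exists N, forall n, N <= n -> forall x, below k x ->
      forall u, P u -> n <= pickle u -> Z u /\ clopen_of u.2 x.
    apply: finite_set_bound (finite_below k) _ => x kx.
    have [|N NP] := PA x; first by right; exact: below_Fin kx.
    by exists N => n Nn u Pu nu; apply: NP => //; exact: leq_trans nu.
  have [M MP] := Pcol k; have [u Pu] := Pinf (maxn k (maxn N M)).
  rewrite !geq_max => /and3P[ku Nu Mu].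
  exists (u, maxn u.1.+1 (clopen_depth u.2)); split=> //=.
  - by have [] := NP N (leqnn N) _ (@trunc_below (finset_pt [::]) k) u Pu Nu.
  - by rewrite MP //= leq_max leqnn.
  - move=> x /misses_trunc xk.
    have [_] := NP N (leqnn N) _ (@trunc_below x k) u Pu Nu.
    by apply: clopen_of_prefix (leq_maxr u.1.+1 _) _ => i ik; exact/esym/xk.
pose K := fix K i := if i is i'.+1 then (step (K i')).2 else 0.
pose u i := (step (K i)).1.
have uK i : K i <= (u i).1 < K i.+1 by case: (stepP (K i)).
have Kmono : {homo K : i j / i < j}.
  by apply: homo_from_step => i; have /andP[] := uK i; exact: leq_ltn_trans.
have Kle : {homo K : i j / i <= j}.
  by move=> i j; rewrite leq_eqVlt => /predU1P[->//|/Kmono/ltnW].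
have uinj i j : (u i).1 = (u j).1 -> i = j.
  move=> e; have /andP[i1 i2] := uK i; have /andP[j1 j2] := uK j.
  case: (ltngtP i j) => // /Kle h.
    by have := leq_trans h j1; rewrite -e leqNgt i2.
  by have := leq_trans h i1; rewrite e leqNgt j2.
have /choice[w wP] n : exists w, Z (n, w) /\ forall i, (u i).1 = n -> w = (u i).2.
  have [[i ui]|noi] := pselect (exists i, (u i).1 = n).
    exists (u i).2; split.
      by have [_ + _ _ _] := stepP (K i); rewrite -/(u i) -ui; case: (u i).
    by move=> j; rewrite -ui => /uinj ->.
  have [w Zw _] := ZO n set0 (finite_set0 _) (fun _ => False_ind _).
  by exists w; split=> // i ui; case: noi; exists i.
exists (fun j => K (j.+1 * j.+1)), w; split=> [n|F finF FA]; first by case: (wP n).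
pose F2 := [set y | infsets y /\ le_star (fun j => K (j.+1 * j.+1)) (enum_of y)].
(* N1 is good for the points of F in A, N2 for those that dominate g. *)
have [N1 N1P] : exists N, forall n, N <= n -> forall x, (F `&` A) x -> clopen_of (u n).2 x.
  apply: finite_set_bound; first exact: finite_setIl.
  move=> x [_ /PA[N NP]]; exists N => n Nn; apply: (NP (u n) _ _).2.
    by case: (stepP (K n)).
  have [_ _ _ ku _] := stepP (K n).
  exact: leq_trans Nn (leq_trans (homo_ge Kmono n) ku).
have finF2 : finite_set (F `&` F2) by exact: finite_setIl.
have [N2 N2P] : exists N, forall n, N <= n -> forall y, (F `&` F2) y ->
    K (n.+1 * n.+1) <= enum_of y n.
  by apply: finite_set_bound finF2 _ => y [_ [_ /le_starP]].
have [ys ysP] := (finite_seqP (F `&` F2)).1 finF2.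
pose j := N1 + N2 + size ys.
have [N1j N2j yj] : [/\ N1 <= j, N2 <= j & size ys <= j] by rewrite /j; split; lia.
clearbody j.
have jj : j.+1 * j.+1 = j * j + j.*2.+1 by rewrite mulSn mulnS -addnn; lia.
have [||i [/andP[N1i _] iP]] := missed_interval (ys := ys) (k := K) (j := j)
  (i0 := N1) (q := j.+1 * j.+1 - N1) Kmono.
- rewrite subnKC; last by rewrite jj; lia.
  move=> y yys; have yF : (F `&` F2) y by rewrite ysP.
  split; first by case: yF => _ [].
  exact: N2P yF.
- have : size ys * j <= j * j by rewrite leq_mul2r yj orbT.
  rewrite jj; move: (size ys * j) (j * j) => a b; lia.
exists (u i).1 => x Fx; have [_ /(_ i erefl) ->] := wP (u i).1.
have [Ax|F2x] := FA x Fx; first exact: N1P.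
have [_ _ _ _] := stepP (K i); apply; apply: iP.
by have : (F `&` F2) x by []; rewrite ysP.
Qed.

(** * Recursion along a well order *)

Lemma well_order_min2 (I : Type) (R : rel I) : wochoice.well_order R ->
  forall i j, exists! z, (z = i \/ z = j) /\ R z i /\ R z j.
Proof.
move=> wo i j.
have [|z [[/asboolP zij zmin] zuniq]] := wo [pred z | `[< z = i \/ z = j >]].
  by exists i; apply/asboolP; left.
exists z; split; first by split=> //; split; apply: zmin; apply/asboolP; [left|right].
move=> z' [z'ij [z'i z'j]]; apply: zuniq; split; first exact/asboolP.
by move=> y /asboolP[->|->].
Qed.

Lemma well_order_total (I : Type) (R : rel I) : wochoice.well_order R -> total R.
Proof.
move=> wo i j; have [z [[[->|->] [zi zj]] _]] := well_order_min2 wo i j.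
  by rewrite zj.
by rewrite zi orbT.
Qed.

Definition segment (I : Type) (R : rel I) (i : I) : set I :=
  [set j | R j i /\ j <> i].

Lemma well_order_ge (I : Type) (R : rel I) : wochoice.well_order R ->
  forall i j, ~ segment R i j -> R i j.
Proof.
move=> wo i j nji; have /orP[//|ji] := well_order_total wo i j.
have [e|ne] := pselect (j = i); last by case: nji.
by move: ji; rewrite e.
Qed.

Lemma well_order_wf (I : Type) (R : rel I) : wochoice.well_order R ->
  well_founded (fun j i => segment R i j).
Proof.
move=> wo i; apply: contrapT => nAcc.
have [|z [[/asboolP nz zmin] _]] :=
    wo [pred z | `[< ~ Acc (fun j i => segment R i j) z >]].
  by exists i; apply/asboolP.
apply: nz; split=> j [jz ne]; apply: contrapT => nj; apply: ne.
have zj : R z j by apply: zmin; apply/asboolP.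
have refl k : R k k by have := well_order_total wo k k; rewrite orbb.
have [w [_ wuniq]] := well_order_min2 wo j z.
have <- : w = j by apply: wuniq; split; [left|split].
by apply: wuniq; split; [right|split].
Qed.

Lemma wf_recursion (I U : Type) (u0 : U) (lt : I -> I -> Prop)
    (Q : I -> (I -> U) -> U -> Prop) : well_founded lt ->
  (forall i f, exists u, Q i f u) ->
  (forall i f f' u, (forall j, lt j i -> f j = f' j) -> Q i f u -> Q i f' u) ->
  exists t, forall i, Q i t (t i).
Proof.
move=> wf Qex Qext.
have /choice[H HP] (a : I * (I -> U)) : exists u, Q a.1 a.2 u by exact: Qex.
pose ext i (f : forall j, lt j i -> U) j :=
  match pselect (lt j i) with left h => f j h | right _ => u0 end.
pose F i f := H (i, ext i f).
exists (Fix wf (fun=> U) F) => i; rewrite Fix_eq.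
  apply: Qext (HP (i, _)) => j ji /=; rewrite /ext.
  by case: pselect.
move=> k f f' ff'; congr (H (k, _)); apply/funext => j; rewrite /ext.
by case: pselect.
Qed.

(** The recursion chooses the function attached to a stage along with the
point of that stage, so that the requirements of the earlier stages are
available to the later ones; by b = c a single function bounds them all. *)
Lemma dominating_hitting_family (I : Type) (R : rel I) (x : I -> cantor_space)
    (D : I -> nat -> seq nat) (G : I -> set cantor_space -> nat -> nat) :
  b_eq_c -> wochoice.well_order R -> (forall i, small (segment R i)) ->
  exists t : I -> cantor_space, forall i,
    [/\ infsets (t i), le_star_sets (x i) (t i),
        forall n, finite_set [set v | supp (t i) v /\ level v = n],
        forall k, block_seq k (D i) -> hits (D i) (t i) &
        forall j, R j i -> le_star (G j (t @` segment R j)) (enum_of (t i))].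
Proof.
move=> bc wo sR.
pose Q i (f : I -> cantor_space * (nat -> nat)) (u : cantor_space * (nat -> nat)) :=
  [/\ u.2 = G i ((fst \o f) @` segment R i),
      infsets u.1 /\ le_star_sets (x i) u.1,
      forall n, finite_set [set v | supp u.1 v /\ level v = n],
      forall k, block_seq k (D i) -> hits (D i) u.1 &
      le_star u.2 (enum_of u.1) /\
      forall j, segment R i j -> le_star (f j).2 (enum_of u.1)].
have [|||t tP] := @wf_recursion I _ (point, fun=> 0) (fun j i => segment R i j) Q.
- exact: well_order_wf.
- move=> i f; pose g := G i ((fst \o f) @` segment R i).
  have [b bP] := small_dominated bc (fun j => (f j).2) (sR i).
  have [t [ti tf tl tD]] :=
    sparse_point (fun n => maxn (enum_of (x i) n) (maxn (g n) (b n))) (D i).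
  exists (t, g); split=> //=.
  + by split=> //; apply: le_star_trans tf; apply: le_fun_star => n; exact: leq_maxl.
  + split=> [|j ji]; last apply: le_star_trans (bP j ji) _;
      apply: le_star_trans tf; apply: le_fun_star => n;
      by rewrite !leq_max leqnn ?orbT.
- move=> i f f' u ff'; rewrite /Q.
  have -> : (fst \o f) @` segment R i = (fst \o f') @` segment R i.
    by apply: eq_imagel => j /ff' /= ->.
  by move=> [? ? ? ? [? fu]]; split=> //; split=> // j ji; rewrite -ff' //; exact: fu.
exists (fst \o t) => i; have [_ [? ?] ? ? [ti tj]] := tP i; split=> // j ji.
have [<- _ _ _ _] := tP j.
by have [->//|ne] := pselect (j = i); apply: tj.
Qed.

(** * The refinement *)

Lemma continuum_enum_sets (I : Type) (T : countType) : [set: nat -> bool] #<= [set: I] ->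
  exists e : I -> set T, forall Z, exists i, e i = Z.
Proof.
move=> /card_le_injP[f [finj _]].
exists (fun i => [set z | exists2 c, f c = i & c (pickle z)]) => Z.
pose c : nat -> bool := fun n => `[< exists2 z, pickle z = n & Z z >].
exists (f c); apply/seteqP; split=> [z [c' /finj ->]|z Zz].
  by move=> /asboolP[z' /(pcan_inj pickleK) <-].
by exists c => //; apply/asboolP; exists z.
Qed.

Lemma continuum_enum_functions (I : Type) (T : countType) (z0 : T) :
  [set: nat -> bool] #<= [set: I] ->
  exists e : I -> nat -> T, forall f, exists i, e i = f.
Proof.
move=> /(@continuum_enum_sets _ (nat * T)%type)[e eP].
exists (fun i n => xget z0 [set z | e i (n, z)]) => f.
have [i ei] := eP [set nz | nz.2 = f nz.1].
by exists i; apply/funext => n; rewrite ei; apply: xget_unique.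
Qed.

Lemma is_min_card_uniq (T U V : Type) (P : set (set T)) (K : set U) (L : set V) :
  is_min_card P K -> is_min_card P L -> K #= L.
Proof.
move=> [[A PA AK] Kmin] [[B PB BL] Lmin]; apply/card_eqPle; split.
  by apply: card_le_trans (Kmin _ PB) _; have /card_eqPle[] := BL.
by apply: card_le_trans (Lmin _ PA) _; have /card_eqPle[] := AK.
Qed.

(** A function that bounds the refinement also bounds the scale, so S is
unbounded and has at least b = c elements. *)
Lemma refinement_card (A S : set cantor_space) : b_eq_c -> b_scale A ->
  refinement le_star_sets A S -> [set: nat -> bool] #= S.
Proof.
move=> [_ bc] [_ unbA _] [_ _ [phi [phiA Aphi]]]; apply/card_eqPle; split.
  apply: card_le_trans (card_image_le enum_of S); apply: bc => -[g gP].
  apply: unbA; exists g => _ [a Aa <-]; apply: le_star_trans (Aphi a Aa) _.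
  by apply: gP; exists (phi a) => //; rewrite -phiA; exists a.
exact: (card_leT S).
Qed.

Lemma omega_family_sub A B Z : A `<=` B -> omega_family B Z -> omega_family A Z.
Proof. by move=> AB BZ n F finF FA; apply: BZ => //; exact: subset_trans FA AB. Qed.

Lemma omega_selection_sub A B Z w :
  A `<=` B -> omega_selection B Z w -> omega_selection A Z w.
Proof.
move=> AB [Zw Bw]; split=> // F finF FA.
by apply: Bw => //; exact: subset_trans FA AB.
Qed.

(** Besides G i, the i-th function g i of an enumeration of all functions is
attached to the stage i, which makes the range of t strongly dominating; the
i-th sequence D i of an enumeration of all sequences of finite lists provides
the blocks. *)
Lemma dominating_refinement (I : Type) (R : rel I) (S : set cantor_space)
    (G : I -> set cantor_space -> nat -> nat) :
  b_eq_c -> [set: I] #= [set: nat -> bool] -> wochoice.well_order R ->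
  (forall i, small (segment R i)) -> S `<=` infsets -> [set: nat -> bool] #= S ->
  exists t : I -> cantor_space,
    [/\ [/\ refinement le_star_sets S (range t),
           Usel id Gamma Gamma (set_type (range t `|` Fin)) &
           forall k : nat,
             ~ Usel (fun=> k) Gamma Gamma (set_type (range t `|` Fin))],
        forall i, infsets (t i) &
        forall i j, R j i -> le_star (G j (t @` segment R j)) (enum_of (t i))].
Proof.
move=> bc IC wo sR Sinf CS.
have CI : [set: nat -> bool] #<= [set: I] by have /card_eqPle[] := IC.
have /card_set_bijP[x [xS xinj xsurj]] : [set: I] #= S := card_eq_trans IC CS.
have [g gP] := continuum_enum_functions 0 CI.
have [D DP] := continuum_enum_functions ([::] : seq nat) CI.
pose G' i Y n := maxn (g i n) (G i Y n).
have [t tP] := dominating_hitting_family x D G' bc wo sR.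
have tinf i : infsets (t i) by case: (tP i).
have tG i j : R j i -> le_star (G j (t @` segment R j)) (enum_of (t i)).
  case: (tP i) => _ _ _ _ + ji => /(_ j ji); apply: le_star_trans.
  by apply: le_fun_star => n; exact: leq_maxr.
exists t; split=> //; split.
- split=> //; first by move=> _ [i _ <-].
  have /choice[phi phiP] y : exists z, forall i, x i = y -> z = t i.
    have [[i xi]|noi] := pselect (exists i, x i = y).
      by exists (t i) => j; rewrite -xi => /xinj ->; rewrite ?inE.
    by exists point => i xi; case: noi; exists i.
  exists phi; split.
    apply/seteqP; split=> [_ [y /xsurj[i _ xi] <-]|_ [i _ <-]].
      by exists i => //; exact/esym/phiP.
    by exists (x i); [exact: xS|exact: phiP].
  by move=> y /xsurj[i _ xi]; rewrite (phiP _ _ xi) -xi; case: (tP i).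
- apply: Usel_id_dominating => //; first by move=> _ [i _ <-].
  move=> f; have [i gi] := gP f.
  apply: small_sub (small_image (f := t) (sR i)) => y [[j _ <-] nfj].
  exists j => //; apply: contrapT => nij; apply: nfj.
  case: (tP j) => _ _ _ _ /(_ i (well_order_ge wo nij)); apply: le_star_trans.
  by apply: le_fun_star => n; rewrite /G' gi leq_maxl.
- move=> k; apply: not_Usel_const => [_ [i _ <-]|E Ek]; first by case: (tP i).
  have [i Di] := DP E; exists (t i); first by exists i.
  by case: (tP i) => _ _ _ + _ => /(_ k); rewrite Di; apply.
Qed.

Theorem theorem9p9 :
  b_eq_c ->
  forall S : set cantor_space,
    (exists A : set cantor_space,
       b_scale A /\ refinement le_star_sets A S) ->
    (exists S' : set cantor_space,
       [/\ refinement le_star_sets S S',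
           Usel id Gamma Gamma (set_type (setU S' Fin)) &
           forall k : nat, (0 < k)%N ->
             ~ Usel (fun _ => k) Gamma Gamma (set_type (setU S' Fin))])
    /\
    (p_eq_c ->
     exists S' : set cantor_space,
       [/\ refinement le_star_sets S S',
           Usel id Gamma Gamma (set_type (setU S' Fin)),
           forall k : nat, (0 < k)%N ->
             ~ Usel (fun _ => k) Gamma Gamma (set_type (setU S' Fin)) &
           S1 Omega Omega (set_type (setU S' Fin))]).
Proof.
move=> bc S [A [bA AS]].
have CS := refinement_card bc bA AS; have Sinf : S `<=` infsets by case: AS.
have [_ _ [I [R [_ [[wo Iinit] Ib _ _]]]]] := bA.
have IC : [set: I] #= [set: nat -> bool] := is_min_card_uniq Ib bc.
have sR i : small (segment R i).
  move=> Ci; apply: (Iinit i); apply: card_le_trans Ci.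
  by have /card_eqPle[] := IC.
split.
  have [t [[ref uid nuk] _ _]] :=
    dominating_refinement (fun _ _ _ => 0) bc IC wo sR Sinf CS.
  by exists (range t); split=> // k _; exact: nuk.
move=> pc.
have [e eP] : exists e : I -> set (nat * seq (seq bool)), forall Z, exists i, e i = Z.
  by apply: continuum_enum_sets; have /card_eqPle[] := IC.
have /choice[g gP] (ZY : set (nat * seq (seq bool)) * set cantor_space) :
    exists g, small ZY.2 -> omega_family (ZY.2 `|` Fin) ZY.1 -> exists w,
      omega_selection
        ((ZY.2 `|` Fin) `|` [set y | infsets y /\ le_star g (enum_of y)]) ZY.1 w.
  case: ZY => Z Y /=.
  have [[sY ZO]|no] := pselect (small Y /\ omega_family (Y `|` Fin) Z).
    by have [g [w wP]] := omega_selection_exists pc sY ZO; exists g => _ _; exists w.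
  by exists (fun=> 0) => sY ZO; case: no.
have [t [[ref uid nuk] tinf tg]] :=
  dominating_refinement (fun i Y => g (e i, Y)) bc IC wo sR Sinf CS.
exists (range t); split=> //.
(* An omega-family Z of the whole space is handled at a stage i: the points
   chosen from that stage on dominate the function attached to it. *)
apply: S1_Omega_clopen => Z ZO; have [i ei] := eP Z.
have [||w wP] := gP (e i, t @` segment R i).
- exact: small_image.
- rewrite ei; apply: omega_family_sub ZO => y [[j _ <-]|Fy]; last by right.
  by left; exists j.
exists w; rewrite -ei; apply: omega_selection_sub wP => y [[j _ <-]|Fy].
  have [ji|nji] := pselect (segment R i j); first by left; left; exists j.
  by right; split=> //; apply: tg; exact: well_order_ge.
by left; right.
Qed.
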